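(* Let $A\in\mathbb R^{n\times n}$, let $F,Q\in\mathbb R^{n\times n}$ be symmetric positive definite, and let $F=LL^\top$ be the Cholesky factorization of $F$. Assume $\mathcal W(L^{-1}AL)\subset\mathbb C^-$, and let $\widetilde X_0\in\mathbb R^{n\times n}$ be symmetric positive semidefinite such that $\widetilde A_{cl,0}=A-F\widetilde X_0$ is stable. Consider the sequence $\{\widetilde X_k\}_{k\ge0}$ generated from $\widetilde X_0$ by the inexact Newton–Kleinman iteration without truncation described in the context, and introduce the matrices $$\widetilde{\mathcal L}_k:=(L^\top\otimes L^\top)\,\widetilde{\mathcal A}_k\,(L^{-\top}\otimes L^{-\top})=I\otimes L^\top\widetilde A_{cl,k}^\top L^{-\top}+L^\top\widetilde A_{cl,k}^\top L^{-\top}\otimes I.$$ If in each outer iteration $k$ the number $\overline{it}_k$ of GMRES iterations satisfies $$\overline{it}_k\ \ge\ -\,2\log\left((1+\sqrt2)\frac{\kappa(F)\,\|\widetilde X_kF\widetilde X_k+Q\|_F}{\lambda_{\min}(Q)}\right)\Bigg/\log\left(1-\frac{\lambda_{\min}^2\big(-(\widetilde{\mathcal L}_k+\widetilde{\mathcal L}_k^\top)/2\big)}{\lambda_{\max}(\widetilde{\mathcal L}_k\widetilde{\mathcal L}_k^\top)}\right),$$ then, for all $k\ge0$, the iterate $\widetilde X_k$ is well defined, symmetric and positive semidefinite, and the matrix $\widetilde A_{cl,k}$ is stable.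
   Context: $\mathbb C^-=\{z\in\mathbb C:\Re(z)<0\}$; $\mathcal W(A)=\{x^HAx:\ x\in\mathbb C^n,\ \|x\|_2=1\}$; $\kappa(F)$ is the 2-norm condition number; $\lambda_{\min},\lambda_{\max}$ are the smallest and largest eigenvalues of a symmetric matrix. A matrix is stable if its eigenvalues lie in the open left half-plane. $\mathcal R(X):=A^\top X+XA-XFX+Q$. Inexact Newton–Kleinman iteration without truncation (with or without line search): given $\widetilde X_k$, let $\widetilde A_{cl,k}:=A-F\widetilde X_k$ and $$\widetilde{\mathcal A}_k:=I\otimes\widetilde A_{cl,k}^\top+\widetilde A_{cl,k}^\top\otimes I\in\mathbb R^{n^2\times n^2},$$ so that $\widetilde{\mathcal A}_k\,\mathrm{vec}(X)=-\mathrm{vec}(\widetilde X_kF\widetilde X_k+Q)$ is equivalent to the Lyapunov equation $\widetilde A_{cl,k}^\top X+X\widetilde A_{cl,k}=-\widetilde X_kF\widetilde X_k-Q$. Run $\overline{it}_k$ iterations of GMRES with zero initial guess on the linear system $\widetilde{\mathcal A}_kx=-\mathrm{vec}(\widetilde X_kF\widetilde X_k+Q)$ and let $\widehat X_{k+1}$ be the $n\times n$ matrix obtained by reshaping the resulting approximate solution. Then set $$\widetilde X_{k+1}=(1-\lambda_k)\widetilde X_k+\lambda_k\widehat X_{k+1},$$ where, if line search is used, $\lambda_k\in(0,1)$ is chosen such that $\|\mathcal R((1-\lambda_k)\widetilde X_k+\lambda_k\widehat X_{k+1})\|_2\le(1-\lambda_k\alpha)\|\mathcal R(\widetilde X_k)\|_2$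 for a fixed $\alpha>0$, and $\lambda_k=1$ if line search is not used. *)

(* Defs.v *)
From mathcomp Require Import all_boot all_order all_algebra.
From mathcomp Require Import all_classical all_reals all_analysis.
From mathcomp Require Import complex mxtens.

Set Implicit Arguments.
Unset Strict Implicit.
Unset Printing Implicit Defensive.

Import Order.TTheory GRing.Theory Num.Theory.

Local Open Scope classical_set_scope.
Local Open Scope ring_scope.

Section Matrices.
Variable R : realType.

Definition norm2 m (x : 'cV[R]_m) : R := Num.sqrt (\sum_i x i 0 ^+ 2).

Definition frobenius m n (M : 'M[R]_(m, n)) : R :=
  Num.sqrt (\sum_i \sum_j M i j ^+ 2).

Definition opnorm2 m n (M : 'M[R]_(m, n)) : R :=
  sup [set norm2 (M *m x) | x in [set x : 'cV[R]_n | norm2 x = 1]].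

Definition cond2 n (M : 'M[R]_n) : R := opnorm2 M * opnorm2 (invmx M).

(* The set of eigenvalues is finite, and for a symmetric matrix of positive
   size it is also nonempty: the infimum and the supremum are attained. *)
Definition lambda_min n (M : 'M[R]_n) : R := inf [set a | eigenvalue M a].
Definition lambda_max n (M : 'M[R]_n) : R := sup [set a | eigenvalue M a].

Definition is_symmetric n (M : 'M[R]_n) : Prop := M^T = M.

Definition posdef n (M : 'M[R]_n) : Prop :=
  forall x : 'cV[R]_n, x != 0 -> 0 < (x^T *m M *m x) 0 0.

Definition possemidef n (M : 'M[R]_n) : Prop :=
  forall x : 'cV[R]_n, 0 <= (x^T *m M *m x) 0 0.

Definition cholesky n (F L : 'M[R]_n) : Prop :=
  [/\ is_trig_mx L, forall i, 0 < L i i & F = L *m L^T].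

Definition complex_mx n (M : 'M[R]_n) : 'M[R[i]]_n :=
  map_mx (real_complex R) M.

Definition stable n (M : 'M[R]_n) : Prop :=
  forall z : R[i], eigenvalue (complex_mx M) z -> complex.Re z < 0.

Definition numerical_range n (M : 'M[R[i]]_n) : set R[i] :=
  [set ((map_mx Num.conj x)^T *m M *m x) 0 0 |
     x in [set x : 'cV[R[i]]_n | sqrtC (\sum_i `|x i 0| ^+ 2) = 1]].

Definition left_half_plane : set R[i] := [set z | complex.Re z < 0].

(* Column stacking: entry (i, j) of X goes to position j * n + i, in agreement
   with the index convention of the Kronecker product *t. *)
Definition vec n (X : 'M[R]_n) : 'cV[R]_(n * n) :=
  \col_k X (mxtens_unindex k).2 (mxtens_unindex k).1.

Definition unvec n (x : 'cV[R]_(n * n)) : 'M[R]_n :=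
  \matrix_(i, j) x (mxtens_index (j, i)) 0.

Lemma vecK n : cancel (@vec n) (@unvec n).
Proof. by move=> X; apply/matrixP=> i j; rewrite !mxE mxtens_indexK. Qed.

Lemma unvecK n : cancel (@unvec n) (@vec n).
Proof.
move=> x; apply/colP=> k; case: (mxtens_indexP k) => i j.
by rewrite !mxE mxtens_indexK.
Qed.

Definition lyapunov_mx n (M : 'M[R]_n) : 'M[R]_(n * n) :=
  1%:M *t M^T + M^T *t 1%:M.

Lemma lyapunov_mx_vec n (M X : 'M[R]_n) :
  lyapunov_mx M *m vec X = vec (M^T *m X + X *m M).
Proof.
apply/colP=> k; case: (mxtens_indexP k) => j i.
rewrite !mxE mxtens_indexK /=.
rewrite (reindex (@mxtens_index n n)) /=; last first.
  by exists (@mxtens_unindex n n) => ? _;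
    rewrite (mxtens_indexK, mxtens_unindexK).
transitivity (\sum_(q : 'I_n) \sum_(p : 'I_n)
   ((j == q)%:R * M p i + M q j * (i == p)%:R) * X p q).
  by rewrite pair_big; apply: eq_bigr => -[q p] _; rewrite !mxE !mxtens_indexK.
transitivity (\sum_(q : 'I_n) (\sum_(p : 'I_n) (j == q)%:R * M p i * X p q
    + \sum_(p : 'I_n) M q j * (i == p)%:R * X p q)).
  apply: eq_bigr => q _; rewrite -big_split.
  by apply: eq_bigr => p _; rewrite mulrDl.
rewrite big_split /=; congr (_ + _).
  rewrite (bigD1 j) //= [X in _ + X]big1 ?addr0 => [|q /negPf qj].
    by apply: eq_bigr => p _; rewrite eqxx mul1r !mxE.
  by apply: big1 => p _; rewrite eq_sym qj !mul0r.
apply: eq_bigr => q _; rewrite (bigD1 i) //= big1 ?addr0 => [|p /negPf pi].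
  by rewrite eqxx mulr1 mulrC.
by rewrite eq_sym pi mulr0 mul0r.
Qed.

Definition krylov N (M : 'M[R]_N) (b : 'cV[R]_N) (m : nat) : {vspace 'cV[R]_N} :=
  <<[seq M ^+ i *m b | i <- iota 0 m]>>%VS.

(* The result of m iterations of GMRES with zero initial guess on M x = b:
   the residual is minimal over the Krylov space. *)
Definition gmres N (M : 'M[R]_N) (b : 'cV[R]_N) (m : nat) (x : 'cV[R]_N) : Prop :=
  x \in krylov M b m /\
  forall y, y \in krylov M b m -> norm2 (b - M *m x) <= norm2 (b - M *m y).

End Matrices.

Section NewtonKleinman.
Variables (R : realType) (n : nat) (A F Q : 'M[R]_n).
Implicit Types X Xhat Y : 'M[R]_n.

Definition riccati X : 'M[R]_n := A^T *m X + X *m A - X *m F *m X + Q.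

Definition Acl X : 'M[R]_n := A - F *m X.

Definition nk_gmres X (m : nat) : set 'M[R]_n :=
  [set unvec x | x in gmres (lyapunov_mx (Acl X)) (- vec (X *m F *m X + Q)) m].

Definition step_length (line_search : bool) (alpha : R) X Xhat (l : R) : Prop :=
  if line_search then
    0 < l < 1 /\
    opnorm2 (riccati ((1 - l) *: X + l *: Xhat))
      <= (1 - l * alpha) * opnorm2 (riccati X)
  else l = 1.

(* The matrices that may arise as k-th iterate for the iteration numbers it and
   the step lengths lam; the k-th iterate is well defined if and only if this
   set is a singleton. *)
Fixpoint nk_iterate (X0 : 'M[R]_n) (it : nat -> nat) (lam : nat -> R) (k : nat)
    : set 'M[R]_n :=
  if k is j.+1 then
    [set Y | exists X Xhat, [/\ nk_iterate X0 it lam j X,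
       nk_gmres X (it j) Xhat & Y = (1 - lam j) *: X + lam j *: Xhat]]
  else [set X0].

Definition Ltilde (L X : 'M[R]_n) : 'M[R]_(n * n) :=
  (L^T *t L^T) *m lyapunov_mx (Acl X) *m ((invmx L)^T *t (invmx L)^T).

Lemma LtildeE (L X : 'M[R]_n) : L \in unitmx ->
  Ltilde L X = 1%:M *t (L^T *m (Acl X)^T *m (invmx L)^T)
             + (L^T *m (Acl X)^T *m (invmx L)^T) *t 1%:M.
Proof.
move=> Lu; have LV : L^T *m (invmx L)^T = 1%:M.
  by rewrite -trmx_mul mulVmx // trmx1.
by rewrite /Ltilde /lyapunov_mx mulmxDr mulmxDl !tensmx_mul !mulmx1 LV.
Qed.

(* When the argument 1 - _ of the second logarithm vanishes, the conventions
   ln 0 = 0 and x / 0 = 0 give the value 0, which is also the limit obtained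
   from log 0 = -oo. *)
Definition it_bound (L X : 'M[R]_n) : R :=
  let Lt := Ltilde L X in
  - 2 * ln ((1 + Num.sqrt 2) *
            (cond2 F * frobenius (X *m F *m X + Q) / lambda_min Q))
  / ln (1 - lambda_min (- (2^-1 *: (Lt + Lt^T))) ^+ 2
            / lambda_max (Lt *m Lt^T)).

End NewtonKleinman.

(* Main.v *)
(* Write B = L^-1 A L.  The assumption on its numerical range says that B is
   negative definite on real vectors, and so is M = L^-1 (A - F X) L =
   B - L^T X L for every positive semidefinite X.  Hence A - F X, being similar
   to M, is stable as soon as X is positive semidefinite, and it suffices to
   propagate symmetry and semidefiniteness.

   The matrix Ltilde is the Lyapunov operator of M, which is negative definite
   too.  Testing the minimality of the GMRES residual with the polynomial
   (1 + w t)^m and passing to Ltilde by the congruence with L^T (x) L^T, whose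
   condition number is at most that of F, the prescribed number of iterations
   makes the Frobenius norm of the residual at most lambda_min Q.  The new
   iterate Xhat then satisfies
     (A - F X)^T Xhat + Xhat (A - F X) <= 0,
   and, with Y = L^T Xhat L, testing M^T Y + Y M <= 0 on an eigenvector v of the
   smallest eigenvalue a of Y gives 2 a <v, M v> <= 0, that is a >= 0. *)

Require Import Defs.
From mathcomp Require Import all_boot all_order all_algebra.
From mathcomp Require Import all_classical all_reals all_analysis.
From mathcomp Require Import complex mxtens.
From mathcomp Require Import ring lra.

Set Implicit Arguments.
Unset Strict Implicit.
Unset Printing Implicit Defensive.

Import Order.TTheory GRing.Theory Num.Theory.

Local Open Scope classical_set_scope.
Local Open Scope ring_scope.

(** * Euclidean geometry and symmetric matrices *)

Definition dot (R : realType) m (x y : 'cV[R]_m) : R := (x^T *m y) 0 0.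

Section Dot.
Variable R : realType.

Lemma dotE m (x y : 'cV[R]_m) : dot x y = \sum_i x i 0 * y i 0.
Proof. by rewrite /dot mxE; apply: eq_bigr => i _; rewrite mxE. Qed.

Lemma dotC m (x y : 'cV[R]_m) : dot x y = dot y x.
Proof. by rewrite !dotE; apply: eq_bigr => i _; rewrite mulrC. Qed.

Lemma dotDr m (x y z : 'cV[R]_m) : dot x (y + z) = dot x y + dot x z.
Proof. by rewrite /dot mulmxDr mxE. Qed.

Lemma dotNr m (x y : 'cV[R]_m) : dot x (- y) = - dot x y.
Proof. by rewrite /dot mulmxN mxE. Qed.

Lemma dotBr m (x y z : 'cV[R]_m) : dot x (y - z) = dot x y - dot x z.
Proof. by rewrite dotDr dotNr. Qed.

Lemma dotZr m a (x y : 'cV[R]_m) : dot x (a *: y) = a * dot x y.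
Proof. by rewrite /dot -scalemxAr mxE. Qed.

Lemma dotDl m (x y z : 'cV[R]_m) : dot (y + z) x = dot y x + dot z x.
Proof. by rewrite ![dot _ x]dotC dotDr. Qed.

Lemma dotNl m (x y : 'cV[R]_m) : dot (- y) x = - dot y x.
Proof. by rewrite ![dot _ x]dotC dotNr. Qed.

Lemma dotBl m (x y z : 'cV[R]_m) : dot (y - z) x = dot y x - dot z x.
Proof. by rewrite ![dot _ x]dotC dotBr. Qed.

Lemma dotZl m a (x y : 'cV[R]_m) : dot (a *: y) x = a * dot y x.
Proof. by rewrite ![dot _ x]dotC dotZr. Qed.

Lemma dot0r m (x : 'cV[R]_m) : dot x 0 = 0.
Proof. by rewrite /dot mulmx0 mxE. Qed.

Lemma dot_mulmxl m n (M : 'M[R]_(m, n)) x y :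
  dot (M *m x) y = dot x (M^T *m y).
Proof. by rewrite /dot trmx_mul mulmxA. Qed.

Lemma dot_mulmxr m n (M : 'M[R]_(m, n)) x y :
  dot x (M *m y) = dot (M^T *m x) y.
Proof. by rewrite dot_mulmxl trmxK. Qed.

Lemma quadE n (M : 'M[R]_n) x : (x^T *m M *m x) 0 0 = dot x (M *m x).
Proof. by rewrite /dot mulmxA. Qed.

Lemma dot_ge0 m (x : 'cV[R]_m) : 0 <= dot x x.
Proof. by rewrite dotE; apply: sumr_ge0 => i _; rewrite -expr2 sqr_ge0. Qed.

Lemma dot_eq0 m (x : 'cV[R]_m) : (dot x x == 0) = (x == 0).
Proof.
rewrite dotE psumr_eq0 => [|i _]; last by rewrite -expr2 sqr_ge0.
apply/allP/eqP => [x0|-> i _]; last by rewrite mxE mulr0 eqxx.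
apply/colP => i; rewrite mxE.
by have := x0 i (mem_index_enum i); rewrite /= mulf_eq0 orbb => /eqP.
Qed.

Lemma dot_gt0 m (x : 'cV[R]_m) : (0 < dot x x) = (x != 0).
Proof. by rewrite lt0r dot_eq0 dot_ge0 andbT. Qed.

Lemma norm2_ge0 m (x : 'cV[R]_m) : 0 <= norm2 x.
Proof. exact: sqrtr_ge0. Qed.

Lemma norm2E m (x : 'cV[R]_m) : norm2 x = Num.sqrt (dot x x).
Proof.
by rewrite /norm2 dotE.
Qed.

Lemma sqr_norm2 m (x : 'cV[R]_m) : norm2 x ^+ 2 = dot x x.
Proof. by rewrite norm2E sqr_sqrtr ?dot_ge0. Qed.

Lemma norm2_eq0 m (x : 'cV[R]_m) : (norm2 x == 0) = (x == 0).
Proof. by rewrite -dot_eq0 -sqr_norm2 sqrf_eq0. Qed.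

Lemma norm2_gt0 m (x : 'cV[R]_m) : (0 < norm2 x) = (x != 0).
Proof. by rewrite lt0r norm2_eq0 norm2_ge0 andbT. Qed.

Lemma norm2Z m a (x : 'cV[R]_m) : norm2 (a *: x) = `|a| * norm2 x.
Proof.
by rewrite !norm2E dotZl dotZr mulrA -expr2 sqrtrM ?sqr_ge0 // sqrtr_sqr.
Qed.

Lemma dot_cauchy_schwarz m (x y : 'cV[R]_m) :
  dot x y ^+ 2 <= dot x x * dot y y.
Proof.
have [->|] := eqVneq y 0; first by rewrite !dot0r expr0n mulr0.
rewrite -dot_gt0 => y0.
have := dot_ge0 (dot y y *: x - dot x y *: y).
rewrite !(dotBl, dotBr, dotZl, dotZr) [dot y x]dotC.
set a := dot y y in y0 *; set b := dot x y; set c := dot x x.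
move=> h; have : 0 <= a * (c * a - b ^+ 2) by lra.
by rewrite pmulr_rge0 // subr_ge0.
Qed.

Lemma dot_le_norm2 m (x y : 'cV[R]_m) : dot x y <= norm2 x * norm2 y.
Proof.
have [xy|/ltW xy] := leP (dot x y) 0.
  by apply: le_trans xy _; rewrite mulr_ge0 ?norm2_ge0.
rewrite -(ler_pXn2r (ltn0Sn 1)) ?nnegrE ?mulr_ge0 ?norm2_ge0 //.
by rewrite exprMn !sqr_norm2 dot_cauchy_schwarz.
Qed.

(** Cauchy-Schwarz applied to |M^T y|^2 = <y, M M^T y> bounds its square by c |y|^2 |M^T y|^2, and
    one factor cancels. This avoids singular values. *)
Lemma trmx_bound m n (M : 'M[R]_(m, n)) (c : R) : 0 <= c ->
  (forall x, dot (M *m x) (M *m x) <= c * dot x x) ->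
  forall y, dot (M^T *m y) (M^T *m y) <= c * dot y y.
Proof.
move=> c0 Mc y; set z := M^T *m y.
have [->|] := eqVneq z 0; first by rewrite dot0r mulr_ge0 ?dot_ge0.
rewrite -dot_gt0 => z0.
have zE : dot z z = dot y (M *m z) by rewrite dot_mulmxr.
have := dot_cauchy_schwarz y (M *m z); rewrite -zE => h.
rewrite -(ler_pM2r z0) -expr2; apply: le_trans h _.
by rewrite [c * _]mulrC -mulrA ler_wpM2l ?dot_ge0.
Qed.

Lemma mulmx_frobenius m n (M : 'M[R]_(m, n)) x :
  norm2 (M *m x) <= frobenius M * norm2 x.
Proof.
rewrite -(ler_pXn2r (ltn0Sn 1)) ?nnegrE ?mulr_ge0 ?norm2_ge0 ?sqrtr_ge0 //.
rewrite exprMn !sqr_norm2 /frobenius sqr_sqrtr; last first.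
  by apply: sumr_ge0 => i _; apply: sumr_ge0 => j _; rewrite sqr_ge0.
rewrite dotE mulr_suml; apply: ler_sum => i _.
have -> : (M *m x) i 0 = dot (row i M)^T x.
  by rewrite /dot trmxK -row_mul [RHS]mxE.
rewrite -expr2; apply: le_trans (dot_cauchy_schwarz _ _) _.
rewrite ler_wpM2r ?dot_ge0 // dotE; apply: ler_sum => j _.
by rewrite !mxE expr2.
Qed.

Lemma mulmx_opnorm2 m n (M : 'M[R]_(m, n)) x :
  norm2 (M *m x) <= opnorm2 M * norm2 x.
Proof.
have [->|] := eqVneq x 0.
  by rewrite mulmx0 norm2E dot0r sqrtr0 norm2E dot0r sqrtr0 mulr0.
rewrite -norm2_gt0 => x0.
have -> : norm2 (M *m x) = norm2 (M *m ((norm2 x)^-1 *: x)) * norm2 x.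
  rewrite -scalemxAr norm2Z ger0_norm ?invr_ge0 ?norm2_ge0 //.
  by rewrite mulrAC mulVf ?mul1r ?gt_eqF.
(* The supremum defining [opnorm2] is only meaningful for a bounded set; the Frobenius norm is an
   upper bound. *)
rewrite ler_wpM2r ?norm2_ge0 //; apply: ub_le_sup.
  exists (frobenius M) => _ [y y1 <-].
  by apply: le_trans (mulmx_frobenius _ _) _; rewrite y1 mulr1.
exists ((norm2 x)^-1 *: x) => //=.
by rewrite norm2Z ger0_norm ?invr_ge0 ?norm2_ge0 // mulVf ?gt_eqF.
Qed.

Lemma opnorm2_ge0 m n (M : 'M[R]_(m, n)) : 0 <= opnorm2 M.
Proof.
rewrite /opnorm2; set E := [set _ | _ in _].
(* There is no unit vector in dimension 0; then the supremum of the empty set is 0 by convention. *)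
have [->|/set0P [y Ey]] := eqVneq E set0; first by rewrite sup0.
have := Ey => -[x x1 yE].
by have := mulmx_opnorm2 M x; rewrite x1 mulr1; apply: le_trans (norm2_ge0 _).
Qed.

End Dot.

Section Spectral.
Variable R : realType.

(* The bound is read off the spectral decomposition of S over R[i]. *)
Lemma symmetric_min_eigenvalue n (S : 'M[R]_n) : (0 < n)%N -> S^T = S ->
  exists2 a, eigenvalue S a & forall x, a * dot x x <= dot x (S *m x).
Proof.
move=> n0 Ssym; pose C : 'M[R[i]]_n := complex_mx S.
have Cherm : C \is hermsymmx.
  apply: realsym_hermsym.
    apply/is_hermitianmxP; rewrite /= expr0 scale1r map_mx_id //.
    by rewrite /C /complex_mx map_trmx Ssym.
  by apply/mxOverP => i j; rewrite mxE complex_real.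
have Creal := hermitian_spectral_diag_real Cherm.
have /hermitian_normalmx /orthomx_spectralP CE := Cherm.
set P := spectralmx C in CE; set D := spectral_diag C in CE Creal.
have Pu : P \is unitarymx by apply: spectral_unitarymx.
pose d i := complex.Re (D 0 i).
have dE i : D 0 i = (d i)%:C%C by rewrite RRe_real // (mxOverP Creal).
pose i0 := Ordinal n0; pose k := [arg min_(i < i0) d i]%O.
have dk i : d k <= d i by rewrite /k; case: arg_minP => // j _; apply.
exists (d k).
  (* [eigenvalue] refers to row eigenvectors: as C = P^-1 D P, row k of P is one for the k-th
     diagonal entry of D. *)
  rewrite -(eigenvalue_map (real_complex R)) -[map_mx _ S]/C /= -dE.
  apply/eigenvalueP; exists (row k P).
    rewrite CE -row_mul !mulmxA mulmxV ?unitarymx_unit // mul1mx row_mul.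
    by rewrite row_diag_mx -scalemxAl -rowE.
  apply/eqP => Pk0; have /row_unitarymxP/(_ k k) := Pu.
  by rewrite Pk0 linear0l eqxx => /esym/eqP; rewrite oner_eq0.
move=> x; rewrite -lecR.
pose y : 'rV[R[i]]_n := map_mx (real_complex R) x^T.
have yC : map_mx Num.conj y^T = map_mx (real_complex R) x.
  by apply/colP => i; rewrite !mxE conj_Creal // complex_real.
(* The row w holds the coordinates of x^T in the eigenbasis. Both quadratic forms become sums of the
   |w_i|^2 with real weights, which are compared term by term. *)
pose w := y *m invmx P.
have wC : P *m map_mx Num.conj y^T = map_mx Num.conj w^T.
  rewrite /w invmx_unitary // trmx_mul map_mxM; congr (_ *m _).
  by apply/matrixP => i j; rewrite !mxE; exact/esym/conjCK.
have wE (e : 'rV[R[i]]_n) :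
    (w *m diag_mx e *m map_mx Num.conj w^T) 0 0 = \sum_i e 0 i * `|w 0 i| ^+ 2.
  rewrite mxE; apply: eq_bigr => i _; rewrite mul_mx_diag !mxE normCK.
  by rewrite mulrAC mulrC mulrA.
have yE (e : 'rV[R[i]]_n) : (w *m diag_mx e *m map_mx Num.conj w^T) 0 0 =
    (y *m (invmx P *m diag_mx e *m P) *m map_mx (real_complex R) x) 0 0.
  by rewrite -wC yC /w !mulmxA.
have -> : (dot x (S *m x))%:C%C = (w *m diag_mx D *m map_mx Num.conj w^T) 0 0.
  by rewrite yE -CE -!map_mxM mxE /dot mulmxA.
have dotx : (dot x x)%:C%C =
    (w *m diag_mx (const_mx 1) *m map_mx Num.conj w^T) 0 0.
  rewrite yE diag_const_mx mulmx1 mulVmx ?unitarymx_unit // mulmx1.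
  by rewrite -map_mxM mxE.
rewrite [(_ * _)%:C%C]rmorphM /= dotx !wE mulr_sumr; apply: ler_sum => i _.
by rewrite mxE mul1r ler_wpM2r ?exprn_ge0 // dE lecR.
Qed.

(** Evaluating the Rayleigh bound at an eigenvector shows that the eigenvalue found above is below
    every other one, so the infimum is attained there. *)
Lemma lambda_min_symmetric n (S : 'M[R]_n) : (0 < n)%N -> S^T = S ->
  eigenvalue S (lambda_min S) /\
  forall x, lambda_min S * dot x x <= dot x (S *m x).
Proof.
move=> n0 Ssym; have [a Sa aS] := symmetric_min_eigenvalue n0 Ssym.
suff -> : lambda_min S = a by [].
have lb_a : lbound [set b | eigenvalue S b] a.
  move=> b /= /eigenvalueP [v vS v0]; have := aS v^T.
  have -> : S *m v^T = b *: v^T by rewrite -[in LHS]Ssym -trmx_mul vS linearZ.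
  by rewrite dotZr ler_pM2r // dot_gt0 trmx_eq0.
apply/eqP; rewrite eq_le; apply/andP; split.
  by apply: ge_inf => //; exists a.
by apply: lb_le_inf => //; exists a.
Qed.

Lemma lambda_maxN n (S : 'M[R]_n) : lambda_max S = - lambda_min (- S).
Proof.
rewrite /lambda_max /lambda_min /inf opprK; congr (sup _).
have eigN (T : 'M[R]_n) b : eigenvalue T b -> eigenvalue (- T) (- b).
  move=> /eigenvalueP [v vT v0]; apply/eigenvalueP; exists v => //.
  by rewrite mulmxN vT scaleNr.
apply/seteqP; split=> [b /= Sb|_ [b /= Sb <-]].
  by exists (- b); [exact: eigN|rewrite opprK].
by rewrite -[S]opprK; exact: eigN.
Qed.

Lemma lambda_max_symmetric n (S : 'M[R]_n) x : (0 < n)%N -> S^T = S ->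
  dot x (S *m x) <= lambda_max S * dot x x.
Proof.
move=> n0 Ssym; have [|_ /(_ x)] := @lambda_min_symmetric _ (- S) n0.
  by rewrite raddfN /= Ssym.
by move=> h; rewrite lambda_maxN mulNr lerNr -dotNr -mulNmx.
Qed.

Lemma lambda_min_gt0 n (S : 'M[R]_n) : (0 < n)%N -> S^T = S -> posdef S ->
  0 < lambda_min S.
Proof.
move=> n0 Ssym Spos.
have [/eigenvalueP [v vS v0] _] := lambda_min_symmetric n0 Ssym.
have vT0 : v^T != 0 by rewrite trmx_eq0.
have := Spos _ vT0; rewrite trmxK vS -scalemxAl mxE.
by have := vT0; rewrite -dot_gt0 /dot trmxK => v1; rewrite pmulr_lgt0.
Qed.

End Spectral.

(** * GMRES and vectorization *)

Section LeastSquares.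
Variable R : realType.

(** If u W^T W = 0 then |W u^T|^2 = 0. Hence W^T W has the rank of W, its row space contains that of
    W, and b^T W lies in it; W may be rank deficient. *)
Lemma normal_equations N p (W : 'M[R]_(N, p)) (b : 'cV[R]_N) :
  exists c : 'cV[R]_p, W^T *m (b - W *m c) = 0.
Proof.
have kerW : (kermx (W^T *m W) <= kermx W^T)%MS.
  apply/row_subP => i; apply/sub_kermxP; set u := row i _.
  have uWW : u *m (W^T *m W) = 0 by rewrite -row_mul mulmx_ker row0.
  apply/eqP; rewrite -trmx_eq0 -dot_eq0 /dot trmxK trmx_mul trmxK.
  by rewrite -mulmxA [W^T *m _]mulmxA mulmxA uWW mul0mx mxE.
have rkW : (\rank W <= \rank (W^T *m W))%N.
  have := mxrankS kerW; rewrite !mxrank_ker mxrank_tr => h.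
  by rewrite leq_sub2lE ?rank_leq_col // in h.
have sub : (W <= W^T *m W)%MS.
  have /leqifP := mxrank_leqif_sup (submxMl W^T W).
  by case: ifP => // _; rewrite ltnNge rkW.
have /submxP [c bc] : (b^T *m W <= W^T *m W)%MS.
  exact: submx_trans (submxMl _ _) sub.
exists c^T; rewrite mulmxBr; apply/eqP; rewrite subr_eq0 -(inj_eq trmx_inj).
by rewrite !trmx_mul !trmxK bc !mulmxA.
Qed.

Lemma dot_pythagoras N (r z : 'cV[R]_N) : dot r z = 0 ->
  dot (r + z) (r + z) = dot r r + dot z z.
Proof. by move=> rz; rewrite dotDl !dotDr [dot z r]dotC rz addr0 add0r. Qed.

(** A basis of K as the columns of B turns the problem into unconstrained least squares for M B. A
    solution of the normal equations is optimal by Pythagoras. *)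
Lemma least_squares_exists N (M : 'M[R]_N) (b : 'cV[R]_N)
    (K : {vspace 'cV[R]_N}) :
  exists2 x, x \in K &
    forall y, y \in K -> norm2 (b - M *m x) <= norm2 (b - M *m y).
Proof.
pose B := \matrix_(i, j) ((vbasis K)`_j) i 0 : 'M[R]_(N, \dim K).
have BE (c : 'cV_(\dim K)) : B *m c = \sum_i c i 0 *: (vbasis K)`_i.
  apply/colP => i; rewrite mxE summxE; apply: eq_bigr => j _.
  by rewrite !mxE mulrC.
have BK y : y \in K -> exists c, y = B *m c.
  move=> /coord_vbasis ->; exists (\col_i coord (vbasis K) i y).
  by rewrite BE; apply: eq_bigr => i _; rewrite mxE.
have [c Wc] := normal_equations (M *m B) b.
exists (B *m c).
  rewrite BE; apply: memv_suml => i _.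
  by rewrite memvZ // vbasis_mem // mem_nth // size_tuple.
move=> y /BK [d ->]; rewrite !norm2E ler_wsqrtr // !mulmxA.
set W := M *m B in Wc *; set r := b - W *m c.
have -> : b - W *m d = r + W *m (c - d) by rewrite mulmxBr addrA subrK.
rewrite dot_pythagoras ?lerDl ?dot_ge0 //.
by rewrite dot_mulmxr Wc dotC dot0r.
Qed.

(** Strict convexity of the norm: by the parallelogram law, |p - q|^2 = 2 |p|^2 + 2 |q|^2 - |p +
    q|^2, which the two hypotheses make nonpositive. *)
Lemma norm2_midpoint_eq N (p q : 'cV[R]_N) :
  norm2 q <= norm2 (2^-1 *: (p + q)) -> norm2 p <= norm2 (2^-1 *: (p + q)) ->
  p = q.
Proof.
have sqr (x y : 'cV[R]_N) : norm2 x <= norm2 y -> dot x x <= dot y y.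
  by move=> xy; rewrite -!sqr_norm2 ler_pXn2r // nnegrE norm2_ge0.
move=> /sqr + /sqr; rewrite !(dotZl, dotZr, dotDl, dotDr) [dot q p]dotC.
move=> h1 h2.
have : dot (p - q) (p - q) <= 0.
  by rewrite !(dotBl, dotBr) [dot q p]dotC; lra.
rewrite le_eqVlt ltNge dot_ge0 orbF dot_eq0 subr_eq0 => /eqP; exact.
Qed.

(** The residual of the midpoint of two minimizers is the midpoint of their residuals, so these
    residuals coincide; M being invertible, so do the minimizers. *)
Lemma least_squares_unique N (M : 'M[R]_N) (b : 'cV[R]_N)
    (K : {vspace 'cV[R]_N}) x x' :
  M \in unitmx -> x \in K -> x' \in K ->
  (forall y, y \in K -> norm2 (b - M *m x) <= norm2 (b - M *m y)) ->
  (forall y, y \in K -> norm2 (b - M *m x') <= norm2 (b - M *m y)) -> x = x'.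
Proof.
move=> Mu xK x'K minx minx'.
pose y := 2^-1 *: (x + x').
have yK : y \in K by rewrite memvZ // memvD.
have := minx _ yK; have := minx' _ yK.
set p := b - M *m x; set q := b - M *m x'.
have -> : b - M *m y = 2^-1 *: (p + q).
  rewrite /p /q addrACA -opprD -mulmxDr scalerBr [in RHS]scalemxAr -/y.
  by rewrite -mulr2n -(scaler_nat 2 b) scalerA mulVf ?scale1r // pnatr_eq0.
move=> /norm2_midpoint_eq h /h /addrI /oppr_inj /(congr1 (mulmx (invmx M))).
by rewrite !mulKmx.
Qed.

Lemma gmres_exists N (M : 'M[R]_N) b m : exists x, gmres M b m x.
Proof.
by have [x xK xmin] := least_squares_exists M b (krylov M b m); exists x.
Qed.

Lemma gmres_unique N (M : 'M[R]_N) b m x x' : M \in unitmx ->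
  gmres M b m x -> gmres M b m x' -> x = x'.
Proof.
move=> Mu [xK xm] [x'K x'm].
exact: (least_squares_unique Mu xK x'K xm x'm).
Qed.

Lemma krylov_power N (M : 'M[R]_N) b m i : (i < m)%N ->
  M ^+ i *m b \in krylov M b m.
Proof.
by move=> im; apply: memv_span; apply/mapP; exists i; rewrite // mem_iota.
Qed.

Lemma krylov_ind N (M : 'M[R]_N) b (P : 'cV[R]_N -> Prop) m :
  P 0 -> (forall x y, P x -> P y -> P (x + y)) ->
  (forall a x, P x -> P (a *: x)) ->
  (forall i, (i < m)%N -> P (M ^+ i *m b)) ->
  forall x, x \in krylov M b m -> P x.
Proof.
move=> P0 PD PZ Pb x; rewrite /krylov -[[seq _ | _ <- _]]/(val (in_tuple _)).
move=> /coord_span ->; apply: (big_ind P) => // i _; apply: PZ => /=.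
set s := map _ _; have : s`_i \in s by apply/mem_nth.
by move=> /mapP [j]; rewrite mem_iota add0n => /andP [_ jm] ->; exact: Pb.
Qed.

Lemma krylovS N (M : 'M[R]_N) b m x : x \in krylov M b m ->
  x \in krylov M b m.+1 /\ M *m x \in krylov M b m.+1.
Proof.
move: x; apply: krylov_ind.
- by rewrite mulmx0 mem0v.
- by move=> x y [? ?] [? ?]; rewrite mulmxDr !memvD.
- by move=> a x [? ?]; rewrite -scalemxAr !memvZ.
- move=> i im; rewrite mulmxA; split; first by apply: krylov_power; exact: ltnW.
  have -> : M *m M ^+ i = M ^+ i.+1 by rewrite exprS.
  exact: krylov_power.
Qed.

(** Richardson iteration: replacing y by y - w (b - M y) changes the residual r into r + w M r and
    enlarges the Krylov space by one dimension at most. The residual polynomial obtained is (1 + w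
    t)^m. *)
Lemma krylov_richardson N (M : 'M[R]_N) b (w : R) m :
  exists2 y, y \in krylov M b m &
    b - M *m y = iter m (fun r => r + w *: (M *m r)) b.
Proof.
elim: m => [|m [y yK ry]]; first by exists 0; rewrite ?mem0v // mulmx0 subr0.
have [yK1 MyK1] := krylovS yK.
exists (y - w *: b + w *: (M *m y)).
  rewrite memvD ?memvB ?memvZ //.
  by have := @krylov_power _ M b m.+1 0 (ltn0Sn m); rewrite expr0 mul1mx.
rewrite iterS -ry !mulmxDr !mulmxN -!scalemxAr scalerBr !opprD opprK.
by rewrite -!addrA.
Qed.

Lemma gmres_residual N (M : 'M[R]_N) b (w : R) m x : gmres M b m x ->
  norm2 (b - M *m x) <= norm2 (iter m (fun r => r + w *: (M *m r)) b).
Proof.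
by move=> [_ xmin]; have [y /xmin h <-] := krylov_richardson M b w m.
Qed.

Lemma iter_contraction N (M : 'M[R]_N) (w rho : R) m b : 0 <= rho ->
  (forall r, dot (r + w *: (M *m r)) (r + w *: (M *m r)) <= rho * dot r r) ->
  dot (iter m (fun r => r + w *: (M *m r)) b)
      (iter m (fun r => r + w *: (M *m r)) b) <= rho ^+ m * dot b b.
Proof.
move=> rho0 h; elim: m => [|m IH]; first by rewrite expr0 mul1r.
rewrite iterS exprS -mulrA; apply: le_trans (h _) _.
by rewrite ler_wpM2l.
Qed.

Lemma iter_intertwine N (S M T : 'M[R]_N) (w : R) m (b : 'cV[R]_N) :
  S *m M = T *m S ->
  S *m iter m (fun r => r + w *: (M *m r)) b =
  iter m (fun r => r + w *: (T *m r)) (S *m b).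
Proof.
move=> ST; elim: m => // m IH.
by rewrite !iterS mulmxDr -scalemxAr mulmxA ST -mulmxA IH.
Qed.

End LeastSquares.

Lemma tensmx11 (R : realType) n : 1%:M *t 1%:M = 1%:M :> 'M[R]_(n * n).
Proof.
apply/matrixP => k l.
case: (mxtens_indexP k) => i1 i2; case: (mxtens_indexP l) => j1 j2.
by rewrite tensmxE !mxE (can_eq (@mxtens_indexK n n)) xpair_eqE -natrM mulnb.
Qed.

Section Vec.
Variables (R : realType) (n : nat).
Implicit Types X Y M : 'M[R]_n.

Lemma vecD X Y : vec (X + Y) = vec X + vec Y.
Proof. by apply/colP => k; rewrite !mxE. Qed.

Lemma vecN X : vec (- X) = - vec X.
Proof. by apply/colP => k; rewrite !mxE. Qed.

Lemma col_mulmx M X j : col j (M *m X) = M *m col j X.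
Proof. by rewrite !colE mulmxA. Qed.

Lemma dot_vec X Y : dot (vec X) (vec Y) = \sum_j dot (col j X) (col j Y).
Proof.
rewrite dotE (reindex (@mxtens_index n n)) /=; last first.
  by exists (@mxtens_unindex n n) => ? _;
    rewrite (mxtens_indexK, mxtens_unindexK).
transitivity (\sum_j \sum_i X i j * Y i j).
  by rewrite pair_big; apply: eq_bigr => -[j i] _; rewrite !mxE !mxtens_indexK.
by apply: eq_bigr => j _; rewrite dotE; apply: eq_bigr => i _; rewrite !mxE.
Qed.

Lemma dot_vec_tr X Y : dot (vec X^T) (vec Y^T) = dot (vec X) (vec Y).
Proof.
rewrite !dot_vec; under eq_bigr do rewrite dotE.
under [RHS]eq_bigr do rewrite dotE.
by rewrite exchange_big; do 2!apply: eq_bigr => ? _; rewrite !mxE.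
Qed.

Lemma norm2_vec X : norm2 (vec X) = frobenius X.
Proof.
rewrite norm2E dot_vec; congr (Num.sqrt _); rewrite exchange_big.
apply: eq_bigr => j _; rewrite dotE; apply: eq_bigr => i _.
by rewrite !mxE expr2.
Qed.

Lemma vec_eq0 X : (vec X == 0) = (X == 0).
Proof.
apply/eqP/eqP => [X0|->]; last by apply/colP => k; rewrite !mxE.
by rewrite -(vecK X) X0; apply/matrixP => i j; rewrite !mxE.
Qed.

Lemma vec_mulmx_bound M X (c : R) :
  (forall x, dot (M *m x) (M *m x) <= c * dot x x) ->
  dot (vec (M *m X)) (vec (M *m X)) <= c * dot (vec X) (vec X).
Proof.
move=> Mc; rewrite !dot_vec mulr_sumr; apply: ler_sum => j _.
by rewrite col_mulmx.
Qed.

Lemma tensmx_vec M X : (M *t M) *m vec X = vec (M *m X *m M^T).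
Proof.
apply/colP=> k; case: (mxtens_indexP k) => j i.
rewrite !mxE mxtens_indexK /= (reindex (@mxtens_index n n)) /=; last first.
  by exists (@mxtens_unindex n n) => ? _;
    rewrite (mxtens_indexK, mxtens_unindexK).
transitivity (\sum_q \sum_p M j q * M i p * X p q).
  by rewrite pair_big; apply: eq_bigr => -[q p] _; rewrite !mxE !mxtens_indexK.
apply: eq_bigr => q _; rewrite !mxE mulr_suml; apply: eq_bigr => p _.
by rewrite -mulrA mulrC.
Qed.

(** On matrices the operator is X -> M X M^T, so the bound on M is used twice: on the columns of X
    M^T, then, after transposition, on the rows of X. *)
Lemma tensmx_vec_bound M (c : R) : 0 <= c ->
  (forall x, dot (M *m x) (M *m x) <= c * dot x x) ->
  forall x, dot ((M *t M) *m x) ((M *t M) *m x) <= c ^+ 2 * dot x x.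
Proof.
move=> c0 Mc x; rewrite -(unvecK x) tensmx_vec.
set X := unvec x; rewrite -mulmxA.
apply: le_trans (vec_mulmx_bound _ Mc) _; rewrite expr2 -mulrA ler_wpM2l //.
rewrite -dot_vec_tr trmx_mul trmxK.
by apply: le_trans (vec_mulmx_bound _ Mc) _; rewrite dot_vec_tr.
Qed.

(** The pairing of X with M^T X is a sum over columns of values of the form of M. The pairing with X
    M has the same shape for X^T, because transposition preserves the Frobenius inner product. *)
Lemma lyapunov_mx_neg M : (forall x, x != 0 -> dot x (M *m x) < 0) ->
  forall x, x != 0 -> dot x (lyapunov_mx M *m x) < 0.
Proof.
move=> Mneg x; rewrite -(unvecK x) lyapunov_mx_vec vec_eq0 => X0.
set X := unvec x in X0 *.
have neg Y : Y != 0 -> dot (vec Y) (vec (M^T *m Y)) < 0.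
  move=> Y0; have le0 y : dot y (M^T *m y) <= 0.
    have [->|y0] := eqVneq y 0; first by rewrite mulmx0 dot0r.
    by rewrite -dot_mulmxl dotC ltW // Mneg.
  rewrite dot_vec; have [j Yj] : exists j, col j Y != 0.
    apply: contra_neqP Y0 => /forallNP h; apply/matrixP => i j.
    by have /negP/negPn/eqP/colP/(_ i) := h j; rewrite !mxE.
  rewrite (bigD1 j) //= ltr_nwDl //; last first.
  - by apply: sumr_le0 => k _; rewrite col_mulmx.
  - by rewrite col_mulmx -dot_mulmxl dotC Mneg.
have XM : vec (X *m M) = vec ((M^T *m X^T)^T) by rewrite trmx_mul !trmxK.
rewrite vecD dotDr XM -[X in dot (vec X) (vec _^T)]trmxK dot_vec_tr.
by rewrite ltr_nwDl ?ltW ?neg ?trmx_eq0.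
Qed.

End Vec.

(** * Convergence rate and negative definite matrices *)

Section Contraction.
Variables (R : realType) (N : nat) (T : 'M[R]_N).
Hypothesis N0 : (0 < N)%N.
Hypothesis Tneg : forall x, x != 0 -> dot x (T *m x) < 0.
Let mu := lambda_min (- (2^-1 *: (T + T^T))).
Let sigma := lambda_max (T *m T^T).

Let mu_bound : 0 < mu /\ forall x, dot x (T *m x) <= - mu * dot x x.
Proof.
have S_sym : (- (2^-1 *: (T + T^T)))^T = - (2^-1 *: (T + T^T)).
  by rewrite raddfN /= linearZ /= raddfD /= trmxK addrC.
have SE x : dot x (- (2^-1 *: (T + T^T)) *m x) = - dot x (T *m x).
  rewrite mulNmx dotNr -scalemxAl dotZr mulmxDl dotDr.
  rewrite -[dot x (T^T *m x)]dot_mulmxl.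
  by rewrite [dot (T *m x) x]dotC; field.
split.
  by apply: lambda_min_gt0 => // x x0; rewrite quadE SE oppr_gt0 Tneg.
move=> x; have [_ /(_ x)] := lambda_min_symmetric N0 S_sym.
by rewrite SE => h; rewrite mulNr lerNr.
Qed.

(** The largest eigenvalue of T T^T directly controls |T^T x|, and [trmx_bound] carries this over to
    T. It is positive because T^T cannot kill a nonzero vector when the form of T is negative
    definite. *)
Let sigma_bound :
  0 < sigma /\ forall x, dot (T *m x) (T *m x) <= sigma * dot x x.
Proof.
have bT x : dot (T^T *m x) (T^T *m x) <= sigma * dot x x.
  rewrite dot_mulmxl trmxK mulmxA; apply: lambda_max_symmetric => //.
  by rewrite trmx_mul trmxK.
have e0 : (const_mx 1 : 'cV[R]_N) != 0.
  apply/eqP => /colP /(_ (Ordinal N0)); rewrite !mxE.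
  by move/eqP; rewrite oner_eq0.
have Te : 0 < dot (T^T *m const_mx 1) (T^T *m const_mx 1).
  rewrite dot_gt0; apply/eqP => Te0; have := Tneg e0.
  by rewrite dot_mulmxr Te0 dotC dot0r ltxx.
have s0 : 0 < sigma.
  by have := lt_le_trans Te (bT _); rewrite pmulr_lgt0 // dot_gt0.
split=> // x; rewrite -{1 2}(trmxK T).
exact: trmx_bound (ltW s0) bT x.
Qed.

(* The step [mu / sigma] minimises the bound
   [1 - 2 w mu + w^2 sigma] on the squared norm of [1 + w T]. *)
Lemma elman_contraction r :
  dot (r + (mu / sigma) *: (T *m r)) (r + (mu / sigma) *: (T *m r))
    <= (1 - mu ^+ 2 / sigma) * dot r r.
Proof.
have [mu0 /(_ r) mub] := mu_bound; have [s0 /(_ r) sb] := sigma_bound.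
rewrite !(dotDl, dotDr, dotZl, dotZr) [dot (T *m r) r]dotC.
set w := mu / sigma; have w0 : 0 <= w by rewrite divr_ge0 ?ltW.
have -> : mu ^+ 2 / sigma = w * mu by rewrite /w; field; rewrite gt_eqF.
have h1 := ler_wpM2l w0 mub; have h2 := ler_wpM2l (mulr_ge0 w0 w0) sb.
have ws : w * w * (sigma * dot r r) = w * mu * dot r r.
  by rewrite /w; field; rewrite gt_eqF.
rewrite ws in h2; lra.
Qed.

(** For the lower bound, the contraction estimate at a nonzero vector bounds a nonnegative quantity
    by the rate times a positive number. *)
Lemma elman_rate : 0 <= 1 - mu ^+ 2 / sigma < 1.
Proof.
have [mu0 _] := mu_bound; have [s0 _] := sigma_bound.
rewrite ltrBlDr ltrDl divr_gt0 ?exprn_gt0 // andbT.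
have := le_trans (dot_ge0 _) (elman_contraction (const_mx 1)).
rewrite pmulr_lge0 // dot_gt0; apply/eqP => /colP /(_ (Ordinal N0)).
by rewrite !mxE => /eqP; rewrite oner_eq0.
Qed.

End Contraction.

(** With c the argument of the first logarithm, exponentiating the bound on m gives rho^m c^2 <= 1,
    while s <= c q because 1 + sqrt 2 >= 1. *)
Lemma iteration_count (R : realType) (s q rho : R) (m : nat) :
  0 <= s -> 0 < q -> 0 <= rho < 1 -> (0 < m)%N ->
  - 2 * ln ((1 + Num.sqrt 2) * (s / q)) / ln rho <= m%:R ->
  s ^+ 2 * rho ^+ m <= q ^+ 2.
Proof.
move=> s0 q0 /andP [rho0 rho1] m0; move: s0 rho0.
rewrite le_eqVlt => /predU1P [<- *|s0]; first by rewrite expr0n mul0r sqr_ge0.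
(* When rho = 0 the bound on m carries no information, since ln 0 = 0; the claim then follows from
   0^m = 0 for positive m. *)
rewrite le_eqVlt => /predU1P [<- _|rho0].
  by rewrite expr0n eqn0Ngt m0 mulr0 sqr_ge0.
set c := (1 + Num.sqrt 2) * (s / q).
have sq0 : 0 <= Num.sqrt 2 :> R by rewrite sqrtr_ge0.
have c0 : 0 < c by rewrite mulr_gt0 ?divr_gt0 // ltr_pwDl.
have lnrho : ln rho < 0 by rewrite ln_lt0 // rho0.
rewrite ler_ndivrMr // => h.
have rc : rho ^+ m * c ^+ 2 <= 1.
  have [rm cm] : 0 < rho ^+ m /\ 0 < c ^+ 2 by rewrite !exprn_gt0.
  rewrite -ler_ln ?posrE ?ltr01 //; last exact: mulr_gt0.
  rewrite ln1 lnM ?posrE // !lnXn //.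
  by rewrite -[_ *+ m]mulr_natl -[_ *+ 2]mulr_natl -lerBrDr sub0r -mulNr.
have sc : s <= c * q.
  have -> : c * q = s + Num.sqrt 2 * s by rewrite /c; field; rewrite gt_eqF.
  by rewrite lerDl mulr_ge0 // ltW.
apply: (@le_trans _ _ ((c * q) ^+ 2 * rho ^+ m)).
  apply: ler_wpM2r; first by rewrite exprn_ge0 ?ltW.
  by rewrite ler_pXn2r // nnegrE ltW // (lt_le_trans s0).
rewrite exprMn mulrAC [_ ^+ 2 * rho ^+ m]mulrC -[leRHS]mul1r.
by rewrite ler_wpM2r ?sqr_ge0.
Qed.

Section NegativeDefinite.
Variable R : realType.

Lemma injective_unitmx N (M : 'M[R]_N) :
  (forall x : 'cV_N, M *m x = 0 -> x = 0) -> M \in unitmx.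
Proof.
move=> Minj; rewrite -unitmx_tr -row_free_unit.
apply/inj_row_free => v vM; apply/eqP; rewrite -trmx_eq0; apply/eqP/Minj.
by rewrite -[M]trmxK -trmx_mul vM trmx0.
Qed.

(** Splitting a left eigenvector as v = (a + i b)^T and taking real and imaginary parts yields <a, M
    a> + <b, M b> = Re z (|a|^2 + |b|^2), whose left side is negative. *)
Lemma neg_stable n (M : 'M[R]_n) :
  (forall x, x != 0 -> dot x (M *m x) < 0) -> stable M.
Proof.
move=> Mneg z /eigenvalueP [v vM v0].
pose a := (map_mx (@complex.Re R) v)^T; pose b := (map_mx (@complex.Im R) v)^T.
have ReD : {morph @complex.Re R : x y / x + y} by move=> [? ?] [? ?].
have ImD : {morph @complex.Im R : x y / x + y} by move=> [? ?] [? ?].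
have aM : M^T *m a = complex.Re z *: a - complex.Im z *: b.
  apply/colP => j; have /rowP/(_ j)/(congr1 (@complex.Re R)) := vM.
  rewrite !mxE (big_morph _ ReD (erefl : complex.Re 0 = 0)) => h.
  transitivity (\sum_i complex.Re (v 0 i * complex_mx M i j)).
    apply: eq_bigr => i _; rewrite !mxE; case: (v 0 i) => p q /=.
    by rewrite mulr0 subr0 mulrC.
  by rewrite h; case: z {vM h} => s t; case: (v 0 j) => p q /=.
have bM : M^T *m b = complex.Im z *: a + complex.Re z *: b.
  apply/colP => j; have /rowP/(_ j)/(congr1 (@complex.Im R)) := vM.
  rewrite !mxE (big_morph _ ImD (erefl : complex.Im 0 = 0)) => h.
  transitivity (\sum_i complex.Im (v 0 i * complex_mx M i j)).
    apply: eq_bigr => i _; rewrite !mxE; case: (v 0 i) => p q /=.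
    by rewrite mulr0 add0r mulrC.
  rewrite h addrC; case: z {vM h aM} => s t; case: (v 0 j) => p q /=.
  by rewrite mulrC addrC.
have le0 x : dot x (M *m x) <= 0.
  have [->|x0] := eqVneq x 0; first by rewrite mulmx0 dot0r.
  by rewrite ltW // Mneg.
have sum : dot a (M *m a) + dot b (M *m b) = complex.Re z * (dot a a + dot b b).
  rewrite !dot_mulmxr aM bM !(dotDl, dotNl, dotZl) [dot b a]dotC.
  by ring.
have [z0|//] := leP 0 (complex.Re z); exfalso.
have ab0 : dot a a + dot b b <> 0.
  move/eqP; rewrite paddr_eq0 ?dot_ge0 // !dot_eq0 => /andP [/eqP a0 /eqP b0].
  move/eqP: v0; apply; apply/rowP => j; rewrite mxE.
  have /colP/(_ j) := a0; have /colP/(_ j) := b0; rewrite !mxE.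
  by case: (v 0 j) => p q /= -> ->.
have : dot a (M *m a) + dot b (M *m b) < 0.
  have [a0|/Mneg a0] := eqVneq a 0; last by rewrite ltr_nwDl.
  have [b0|/Mneg b0] := eqVneq b 0; last by rewrite ltr_wnDl.
  by case: ab0; rewrite a0 b0 dot0r addr0.
by rewrite sum ltNge mulr_ge0 // addr_ge0 ?dot_ge0.
Qed.

(** A real unit vector, seen as a complex one, yields a real point of the numerical range; a general
    x is normalised first. *)
Lemma numerical_range_neg n (B : 'M[R]_n) :
  numerical_range (complex_mx B) `<=` @left_half_plane R ->
  forall x, x != 0 -> dot x (B *m x) < 0.
Proof.
move=> Bneg x; rewrite -norm2_gt0 => x0.
pose u := (norm2 x)^-1 *: x; pose v := map_mx (real_complex R) u.
have u1 : dot u u = 1.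
  rewrite dotZl dotZr -sqr_norm2 mulrA -invfM -expr2 mulVf //.
  by rewrite expf_neq0 // gt_eqF.
have : left_half_plane (dot u (B *m u))%:C%C.
  apply: Bneg; exists v => /=.
    have -> : \sum_i `|v i 0| ^+ 2 = (dot u u)%:C%C.
      rewrite dotE (rmorph_sum (real_complex R)); apply: eq_bigr => i _ /=.
      by rewrite mxE real_normK ?complex_real // rmorphM /= expr2.
    by rewrite u1 sqrtC1.
  have -> : (map_mx Num.conj v)^T = map_mx (real_complex R) u^T.
    by apply/rowP => i; rewrite !mxE conj_Creal // complex_real.
  by rewrite -!map_mxM mxE quadE.
rewrite /left_half_plane /= -scalemxAr dotZl dotZr.
by rewrite pmulr_rlt0 ?invr_gt0 // pmulr_rlt0 ?invr_gt0.
Qed.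

End NegativeDefinite.

(** * Preservation of semidefiniteness along the iteration *)

Section Cholesky.
Variables (R : realType) (n : nat) (F L : 'M[R]_n).
Hypothesis chol : cholesky F L.

Lemma cholesky_unitmx : L \in unitmx.
Proof.
have [Ltri Lpos _] := chol.
rewrite unitmxE unitfE det_trig //; apply/prodf_neq0 => i _.
by rewrite gt_eqF.
Qed.

(** Here |L^T x|^2 = <x, F x>, so that the squared norm of L^T is controlled by the norm of F
    itself. *)
Lemma cholesky_bound x : dot (L^T *m x) (L^T *m x) <= opnorm2 F * dot x x.
Proof.
have [_ _ ->] := chol.
rewrite dot_mulmxl trmxK mulmxA; apply: le_trans (dot_le_norm2 _ _) _.
by rewrite -sqr_norm2 expr2 mulrCA ler_wpM2l ?norm2_ge0 // mulmx_opnorm2.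
Qed.

(** Since F^-1 = L^-T L^-1, one has |L^-1 x|^2 = <x, F^-1 x>; the bound passes to L^-T by
    [trmx_bound]. *)
Lemma cholesky_inv_bound x :
  dot ((invmx L)^T *m x) ((invmx L)^T *m x) <= opnorm2 (invmx F) * dot x x.
Proof.
have Lu := cholesky_unitmx; have [_ _ FE] := chol.
have invF : invmx F = (invmx L)^T *m invmx L.
  have Fu : F \in unitmx by rewrite FE unitmx_mul unitmx_tr Lu.
  rewrite -[RHS](mulKmx Fu) [in F *m _]FE -!mulmxA [L^T *m _]mulmxA.
  by rewrite -trmx_mul mulVmx // trmx1 mul1mx mulmxV // mulmx1.
apply: trmx_bound => [|{}x]; first exact: opnorm2_ge0.
rewrite dot_mulmxl mulmxA -invF; apply: le_trans (dot_le_norm2 _ _) _.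
by rewrite -sqr_norm2 expr2 mulrCA ler_wpM2l ?norm2_ge0 // mulmx_opnorm2.
Qed.

End Cholesky.

Section KleinmanStep.
Variables (R : realType) (n : nat) (A F Q L X : 'M[R]_n).
Hypothesis n0 : (0 < n)%N.
Hypotheses (Fsym : is_symmetric F) (Qsym : is_symmetric Q) (Qpos : posdef Q).
Hypothesis chol : cholesky F L.
Hypothesis rangeA :
  numerical_range (complex_mx (invmx L *m A *m L)) `<=` @left_half_plane R.
Hypotheses (Xsym : is_symmetric X) (Xpos : possemidef X).

Let Lu := cholesky_unitmx chol.
Let G := Acl A F X.
Let M := invmx L *m G *m L.
Let W := X *m F *m X + Q.

Let Mneg x : x != 0 -> dot x (M *m x) < 0.
Proof.
move=> x0; have [_ _ FE] := chol.
have -> : M = invmx L *m A *m L - L^T *m X *m L.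
  by rewrite /M /G /Acl mulmxBr mulmxBl FE -!mulmxA mulKmx.
rewrite mulmxBl dotBr subr_lt0.
apply: lt_le_trans (numerical_range_neg rangeA x0) _.
by rewrite -!mulmxA dot_mulmxr trmxK -quadE.
Qed.

Let MTneg x : x != 0 -> dot x (M^T *m x) < 0.
Proof. by move=> x0; rewrite -dot_mulmxl dotC Mneg. Qed.

(** Right multiplication by L maps row eigenvectors of A - F X to row eigenvectors of M = L^-1 (A -
    F X) L, with the same eigenvalue. *)
Lemma Acl_stable : stable (Acl A F X).
Proof.
move=> z /eigenvalueP [v vG v0]; apply: (neg_stable Mneg).
apply/eigenvalueP; exists (v *m complex_mx L).
  rewrite /M /complex_mx !map_mxM map_invmx -!mulmxA mulKVmx ?map_unitmx //.
  by rewrite mulmxA vG scalemxAl.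
apply: contra v0 => /eqP vL.
by rewrite -[v](@mulmxK _ _ _ (complex_mx L)) ?map_unitmx // vL mul0mx.
Qed.

Let T := Ltilde A F L X.

Let TE : T = lyapunov_mx M.
Proof. by rewrite /T LtildeE // /lyapunov_mx /M !trmx_mul !mulmxA. Qed.

Let Tneg x : x != 0 -> dot x (T *m x) < 0.
Proof. by rewrite TE; apply: lyapunov_mx_neg. Qed.

Let S := L^T *t L^T.
Let Sinv := (invmx L)^T *t (invmx L)^T.

Let SinvS : Sinv *m S = 1%:M.
Proof. by rewrite tensmx_mul -trmx_mul mulmxV // trmx1 tensmx11. Qed.

Let S_lyapunov : S *m lyapunov_mx G = T *m S.
Proof. by rewrite /T /Ltilde -!mulmxA SinvS mulmx1. Qed.

(** A nonzero kernel vector x would give a nonzero S x in the kernel of T, against negative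
    definiteness. Invertibility is what makes the GMRES iterate unique. *)
Lemma lyapunov_mx_unit : lyapunov_mx (Acl A F X) \in unitmx.
Proof.
apply: injective_unitmx => x Gx; apply/eqP/negPn/negP => x0.
have Sx0 : S *m x != 0.
  by apply: contra x0 => /eqP Sx; rewrite -[x]mul1mx -SinvS -mulmxA Sx mulmx0.
by have := Tneg Sx0; rewrite mulmxA -S_lyapunov -mulmxA Gx mulmx0 dot0r ltxx.
Qed.

(** The target [lambda_min Q] is the size at which the residual can no longer outweigh Q in the
    Lyapunov equation. *)
Let residual_bound m x :
  (0 < m)%N -> it_bound A F Q L X <= m%:R ->
  gmres (lyapunov_mx G) (- vec W) m x ->
  norm2 (- vec W - lyapunov_mx G *m x) <= lambda_min Q.
Proof.
move=> m0 itm xg.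
have q0 := lambda_min_gt0 n0 Qsym Qpos.
have N0 : (0 < n * n)%N by rewrite muln_gt0 n0.
pose mu := lambda_min (- (2^-1 *: (T + T^T))).
pose sigma := lambda_max (T *m T^T).
pose rho := 1 - mu ^+ 2 / sigma.
have rhoP : 0 <= rho < 1 := elman_rate N0 Tneg.
pose s := cond2 F * frobenius W.
have s0 : 0 <= s by rewrite !mulr_ge0 ?opnorm2_ge0 ?sqrtr_ge0.
rewrite -(ler_pXn2r (ltn0Sn 1)) ?nnegrE ?norm2_ge0 ?(ltW q0) //.
apply: le_trans (iteration_count s0 q0 rhoP m0 itm).
have := gmres_residual (mu / sigma) xg.
rewrite -(ler_pXn2r (ltn0Sn 1)) ?nnegrE ?norm2_ge0 // => /le_trans; apply.
rewrite sqr_norm2; set z := iter _ _ _.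
(* Writing z = S^-1 (S z) moves the iteration from the Lyapunov operator of G to T, where it
   contracts. The squared bounds on S^-1 and S are the squared norms of F^-1 and F, whose product is
   the square of [cond2 F]. *)
rewrite -[z]mul1mx -SinvS -mulmxA.
apply: le_trans (tensmx_vec_bound _ (cholesky_inv_bound chol) _) _.
  exact: opnorm2_ge0.
rewrite (iter_intertwine _ _ _ S_lyapunov).
have -> : s ^+ 2 * rho ^+ m =
    opnorm2 (invmx F) ^+ 2 * (rho ^+ m * (opnorm2 F ^+ 2 * frobenius W ^+ 2)).
  by rewrite /s /cond2; set p := rho ^+ m; ring.
apply: ler_wpM2l; first exact: sqr_ge0.
have [rho0 _] := andP rhoP.
apply: le_trans (iter_contraction _ _ rho0 (elman_contraction N0 Tneg)) _.
apply: ler_wpM2l; first exact: exprn_ge0.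
apply: le_trans (tensmx_vec_bound _ (cholesky_bound chol) _) _.
  exact: opnorm2_ge0.
by rewrite dotNl dotNr opprK -sqr_norm2 norm2_vec.
Qed.

Let W_sym : W^T = W.
Proof. by rewrite /W raddfD /= !trmx_mul Xsym Fsym Qsym mulmxA. Qed.

Let unvecD (x y : 'cV[R]_(n * n)) : unvec (x + y) = unvec x + unvec y.
Proof. by apply/matrixP => i j; rewrite !mxE. Qed.

Let unvecZ a (x : 'cV[R]_(n * n)) : unvec (a *: x) = a *: unvec x.
Proof. by apply/matrixP => i j; rewrite !mxE. Qed.

(* Every Krylov vector is symmetric since the Lyapunov operator preserves
   symmetry and the right-hand side is symmetric. *)
Lemma nk_gmres_sym m Xhat : nk_gmres A F Q X m Xhat -> is_symmetric Xhat.
Proof.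
rewrite /is_symmetric; move=> [x [xK _] <-]; move: x xK.
apply: krylov_ind => [|x y xs ys|a x xs|i _].
- by apply/matrixP => i j; rewrite !mxE.
- by rewrite unvecD raddfD /= xs ys.
- by rewrite unvecZ linearZ /= xs.
rewrite -vecN -/W; elim: i => [|i IH].
  by rewrite expr0 mul1mx vecK raddfN /= W_sym.
rewrite exprS -mulmxA -[X in lyapunov_mx _ *m X]unvecK lyapunov_mx_vec vecK.
by rewrite raddfD /= !trmx_mul trmxK IH addrC.
Qed.

Lemma nk_gmres_possemidef m Xhat : it_bound A F Q L X <= m%:R ->
  nk_gmres A F Q X m Xhat -> possemidef Xhat.
Proof.
case: m => [|m] itm Xg.
  (* The bound is 0 when the rate of elman_contraction vanishes, so that m = 0
     is possible; then Xhat = 0. *)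
  case: Xg => x [x0 _] <- y.
  rewrite /krylov span_nil memv0 in x0; move/eqP: x0 => ->.
  suff -> : unvec 0 = 0 :> 'M[R]_n by rewrite mulmx0 mul0mx mxE.
  by apply/matrixP => i j; rewrite !mxE.
have Xhs := nk_gmres_sym Xg; case: Xg => x xg xE.
have := residual_bound (ltn0Sn m) itm xg.
rewrite -[x in _ - _ *m x]unvecK xE lyapunov_mx_vec -!vecN -vecD norm2_vec.
set Lyap := G^T *m Xhat + Xhat *m G; set Res := - W - Lyap => ResQ.
(* In -W - Res the term X F X has a sign, and Q absorbs the residual because the Frobenius norm
   dominates the action of Res on vectors. *)
have lyap_le0 u : dot u (Lyap *m u) <= 0.
  have -> : Lyap = - W - Res by rewrite /Res opprB addrC subrK.
  rewrite mulmxBl mulNmx dotBr dotNr /W mulmxDl dotDr.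
  have XFX : 0 <= dot u (X *m F *m X *m u).
    have [_ _ ->] := chol; rewrite -!mulmxA dot_mulmxr Xsym.
    by rewrite [dot _ (L *m _)]dot_mulmxr dot_ge0.
  have Qu : lambda_min Q * dot u u <= dot u (Q *m u).
    by have [_] := lambda_min_symmetric n0 Qsym.
  have Ru : - dot u (Res *m u) <= lambda_min Q * dot u u.
    rewrite -dotNl; apply: le_trans (dot_le_norm2 _ _) _.
    rewrite -scaleN1r norm2Z normrN1 mul1r -sqr_norm2 expr2 mulrCA.
    rewrite ler_wpM2l ?norm2_ge0 //; apply: le_trans (mulmx_frobenius _ _) _.
    by rewrite ler_wpM2r ?norm2_ge0.
  lra.
pose Y := L^T *m Xhat *m L.
have Ysym : Y^T = Y by rewrite /Y !trmx_mul trmxK Xhs mulmxA.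
have [a /eigenvalueP [v vY v0] aY] := symmetric_min_eigenvalue n0 Ysym.
have y0 : v^T != 0 by rewrite trmx_eq0.
have Yy : Y *m v^T = a *: v^T by rewrite -[Y]Ysym -trmx_mul vY linearZ.
(* Congruence by L turns the Lyapunov expression in G and Xhat into the one in M and Y. *)
have LyapE : L^T *m Lyap *m L = M^T *m Y + Y *m M.
  rewrite /Lyap /M /Y mulmxDr mulmxDl !trmx_mul -!mulmxA.
  rewrite mulKVmx // [(invmx L)^T *m _]mulmxA -trmx_mul mulmxV //.
  by rewrite trmx1 mul1mx.
have : 2 * a * dot v^T (M *m v^T) <= 0.
  suff -> : 2 * a * dot v^T (M *m v^T) =
    dot (L *m v^T) (Lyap *m (L *m v^T)) by [].
  have LyapL : L^T *m (Lyap *m (L *m v^T)) = (M^T *m Y + Y *m M) *m v^T.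
    by rewrite -LyapE !mulmxA.
  rewrite dot_mulmxl LyapL mulmxDl dotDr.
  rewrite -[M^T *m Y *m _]mulmxA -[Y *m M *m _]mulmxA Yy -scalemxAr dotZr.
  rewrite -[dot _ (M^T *m _)]dot_mulmxl [dot (M *m _) _]dotC.
  by rewrite [dot _ (Y *m _)]dot_mulmxr Ysym Yy dotZl; ring.
(* As <v, M v> < 0, the smallest eigenvalue a of Y is nonnegative. Substituting x = L y then brings
   semidefiniteness back from Y to Xhat. *)
rewrite nmulr_lle0 ?Mneg // pmulr_rge0 // => a0 x1.
rewrite quadE -[x1](mulKVmx Lu); set y := invmx L *m x1.
have -> : dot (L *m y) (Xhat *m (L *m y)) = dot y (Y *m y).
  by rewrite dot_mulmxl !mulmxA.
by apply: le_trans (aY y); rewrite mulr_ge0 ?dot_ge0.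
Qed.

End KleinmanStep.

Theorem theorem3p1 (R : realType) (n : nat) (A F Q L X0 : 'M[R]_n)
    (line_search : bool) (alpha : R) (it : nat -> nat) (lam : nat -> R) :
  (0 < n)%N ->
  is_symmetric F -> posdef F ->
  is_symmetric Q -> posdef Q ->
  cholesky F L ->
  numerical_range (complex_mx (invmx L *m A *m L)) `<=` @left_half_plane R ->
  is_symmetric X0 -> possemidef X0 ->
  stable (Acl A F X0) ->
  0 < alpha ->
  forall k : nat,
  (forall (j : nat) (X : 'M[R]_n), (j < k)%N ->
     nk_iterate A F Q X0 it lam j X -> it_bound A F Q L X <= (it j)%:R) ->
  (forall (j : nat) (X Xhat : 'M[R]_n), (j < k)%N ->
     nk_iterate A F Q X0 it lam j X -> nk_gmres A F Q X (it j) Xhat ->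
     step_length A F Q line_search alpha X Xhat (lam j)) ->
  exists Xk : 'M[R]_n,
    [/\ nk_iterate A F Q X0 it lam k = [set Xk],
        is_symmetric Xk, possemidef Xk & stable (Acl A F Xk)].
Proof.
move=> n0 Fsym _ Qsym Qpos chol rangeA X0sym X0pos X0st _.
elim=> [|k IH] itP stepP; first by exists X0.
have [| |X [XE Xsym Xpos _]] := IH.
- by move=> j X /ltnW; exact: itP.
- by move=> j X Xhat /ltnW; exact: stepP.
have Xk : nk_iterate A F Q X0 it lam k X by rewrite XE.
have itk := itP k X (ltnSn k) Xk.
have Gu := lyapunov_mx_unit chol rangeA Xpos.
(* An actual GMRES iterate is needed before the step length hypothesis can be applied; its
   uniqueness later makes the set of new iterates a singleton. *)
have [x xg] := gmres_exists (lyapunov_mx (Acl A F X))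
  (- vec (X *m F *m X + Q)) (it k).
have Xg : nk_gmres A F Q X (it k) (unvec x) by exists x.
have Xhsym := nk_gmres_sym Fsym Qsym Xsym Xg.
have Xhpos := nk_gmres_possemidef n0 Fsym Qsym Qpos chol rangeA Xsym Xpos
  itk Xg.
(* With or without line search, the new iterate is a convex combination of two positive semidefinite
   matrices. *)
have /andP [l0 l1] : 0 <= lam k <= 1.
  have := stepP k X _ (ltnSn k) Xk Xg; rewrite /step_length.
  case: line_search {stepP IH} => [[/andP [/ltW -> /ltW ->]]|->] //.
  by rewrite ler01 lexx.
pose Y := (1 - lam k) *: X + lam k *: unvec x.
have Ypos : possemidef Y.
  move=> y; rewrite quadE mulmxDl dotDr -!scalemxAl !dotZr -!quadE.
  by rewrite addr_ge0 // mulr_ge0 // subr_ge0.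
exists Y; split => //.
- apply/seteqP; split=> [Z /= [X' [Xhat [X'k [x' x'g <-] ->]]]|_ ->].
    have X'E : X' = X by move: X'k; rewrite XE.
    by rewrite X'E in x'g *; rewrite (gmres_unique Gu x'g xg).
  by exists X, (unvec x).
- by rewrite /is_symmetric raddfD /= !linearZ /= Xsym Xhsym.
- exact: Acl_stable chol rangeA Ypos.
Qed.
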